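(* Let $R$ be a complete discrete valuation ring with maximal ideal $\mathfrak{p}=pR$, residue field $\mathbb{F}_q=R/\mathfrak{p}$, and field of fractions $F$. Fix $n\ge1$, $\gamma=\begin{pmatrix}0&1\\ p^n&0\end{pmatrix}$, $\mathcal{O}=\begin{pmatrix}R&R\\ \mathfrak{p}^n&R\end{pmatrix}$. For each $s\in R/\mathfrak{p}$ choose $b_s\in R$ representing $s$, set $\alpha_s=\begin{pmatrix}1&b_s\\0&p\end{pmatrix}$, $S_1=\{\mathcal{O}\alpha_s\}$, $S_2=\{\mathcal{O}\gamma^{-1}\alpha_s\gamma\}$. Let $\omega\in\mathcal{O}^\times$ and let $\sigma_\omega(P)=P\omega$, which permutes each of $S_1$ and $S_2$. Suppose that for $i=1,2$, all cycles of $\sigma_\omega|_{S_i}$ of length greater than $1$ have a common length $\ell_i$, and that $\ell_1>1$ and $\ell_2>1$. If $q$ is prime (i.e. $q=\operatorname{char}(\mathbb{F}_q)$), or if $\operatorname{trd}(\omega)^2-4\operatorname{nrd}(\omega)\notin\mathfrak{p}$, then $\ell_1=\ell_2$.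
   Context: $\operatorname{nrd}=\det$ and $\operatorname{trd}=$ trace on $\operatorname{M}_2(F)$. (It is known that all non-trivial cycles of such permutations have a common length.) *)

(* Defs.v *)
From HB Require Import structures.
From mathcomp Require Import all_boot all_order all_algebra.
From mathcomp Require Import fraction ring_quotient.
From mathcomp Require Import boolp classical_sets.

Set Implicit Arguments.
Unset Strict Implicit.
Unset Printing Implicit Defensive.

Import GRing.Theory.
Local Open Scope ring_scope.
Local Open Scope classical_set_scope.

Definition principal_ideal (R : comNzRingType) (a : R) : set R :=
  range (fun x => a * x).

(* [idealr_closed] only describes proper ideals, so [maximal_ideal] need not
   mention the unit ideal, and [principal_ideal_domain] omits it because it is
   generated by 1. *)
Definition maximal_ideal (R : comNzRingType) (m : set R) : Prop :=
  idealr_closed [in m] /\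
  forall I : set R, idealr_closed [in I] -> m `<=` I -> I = m.

Definition principal_ideal_domain (R : idomainType) : Prop :=
  forall I : set R, idealr_closed [in I] -> exists a : R, I = principal_ideal a.

Definition is_dvr (R : idomainType) (m : set R) : Prop :=
  [/\ principal_ideal_domain R,
      forall I : set R, maximal_ideal I <-> I = m &
      m <> [set 0]].

Definition adically_complete (R : comNzRingType) (p : R) : Prop :=
  forall u : nat -> R,
    (forall m : nat, exists N : nat, forall i j : nat, (N <= i)%N -> (N <= j)%N ->
       principal_ideal (p ^+ m) (u i - u j)) ->
    exists l : R, forall m : nat, exists N : nat, forall i : nat, (N <= i)%N ->
       principal_ideal (p ^+ m) (u i - l).

(* [red] presents [k] as the quotient of [R] by the ideal [m]. *)
Definition is_quotient_map (R k : comNzRingType) (m : set R)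
    (red : {rmorphism R -> k}) : Prop :=
  (forall s : k, exists x : R, red x = s) /\ (forall x : R, red x = 0 <-> m x).

Definition mx22 (F : fieldType) (a b c d : F) : 'M[F]_2 :=
  \matrix_(i < 2, j < 2)
    if i == 0 then (if j == 0 then a else b) else (if j == 0 then c else d).

Section Orders.
Variables (R : idomainType) (p : R) (n : nat).
Local Notation F := {fraction R}.
Local Notation iota := (@tofrac R).

Definition gamma_mx : 'M[F]_2 := mx22 0 1 (iota (p ^+ n)) 0.

Definition order_O : set 'M[F]_2 :=
  [set A | exists a b c d : R,
     principal_ideal (p ^+ n) c /\
     A = mx22 (iota a) (iota b) (iota c) (iota d)].

Definition order_units : set 'M[F]_2 :=
  [set A | order_O A /\ exists B, [/\ order_O B, A * B = 1 & B * A = 1]].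

Definition right_translate (w : 'M[F]_2) (P : set 'M[F]_2) : set 'M[F]_2 :=
  [set x * w | x in P].

Definition alpha_mx (x : R) : 'M[F]_2 := mx22 1 (iota x) 0 (iota p).

Definition S_1 (k : Type) (b : k -> R) : set (set 'M[F]_2) :=
  range (fun s => right_translate (alpha_mx (b s)) order_O).

Definition S_2 (k : Type) (b : k -> R) : set (set 'M[F]_2) :=
  range (fun s =>
    right_translate (gamma_mx^-1 * alpha_mx (b s) * gamma_mx) order_O).

End Orders.

Definition is_cycle_on (T : eqType) (f : T -> T) (S : set T) (c : seq T) : Prop :=
  [/\ c != [::], ufcycle f c & forall x, x \in c -> S x].

(* The first conjunct makes [l] unique: it is 1 if [f] is the identity on [S],
   and otherwise some nontrivial cycle has length [l]. *)
Definition common_cycle_length (T : eqType) (f : T -> T) (S : set T) (l : nat)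
    : Prop :=
  (exists2 c : seq T, is_cycle_on f S c & size c = l) /\
  (forall c : seq T, is_cycle_on f S c -> (1 < size c)%N -> size c = l).

(* Main.v *)
(* Write w = [[x, y], [p^n z, t]]. Sending s to O alpha_s identifies S_1 with
   the residue field k, and right translation by w becomes the affine map
   s |-> (t/x) s + y/x of k. Conjugation by gamma maps S_2 to S_1 and w to
   [[t, z], [p^n y, x]], so on S_2 one gets s |-> (x/t) s + z/t. A non-fixed
   point of s |-> a s + c is fixed by the j-th iterate exactly when
   1 + a + ... + a^(j-1) = 0, a condition invariant under a |-> 1/a. *)

Require Import Defs.
From HB Require Import structures.
From mathcomp Require Import all_boot all_order all_algebra.
From mathcomp Require Import fraction ring_quotient.
From mathcomp Require Import boolp classical_sets.
From mathcomp Require Import ring.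

Set Implicit Arguments.
Unset Strict Implicit.
Unset Printing Implicit Defensive.

Import GRing.Theory.
Local Open Scope ring_scope.
Local Open Scope classical_set_scope.

(** * Orbits of affine maps over a field *)

Section AffineCycles.

(** The head of the list serves as base point: the list is its orbit, and an early return would
    repeat an entry. *)
Lemma cycle_period (T : eqType) (f : T -> T) (S : set T) (c : seq T) :
  is_cycle_on f S c ->
  exists x, [/\ S x, iter (size c) f x = x &
    forall j, (0 < j < size c)%N -> iter j f x <> x].
Proof.
case: c => [|x c] [] // _ /andP[cyc uc] cS; exists x.
have /fpathP[N def_c] := cyc.
have defN : N = (size c).+1.
  by rewrite -(size_traject f (f x) N) -def_c size_rcons.
(* Indices shift by one, since the trajectory starts at [f x]; the closing [x] sits at position
   [size c]. *)
have nth_c j : (j < N)%N -> nth x (rcons c x) j = iter j.+1 f x.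
  move=> lt_jN; rewrite def_c (set_nth_default (f x)) ?size_traject //.
  by rewrite nth_traject // iterSr.
split; first by apply: cS; rewrite mem_head.
  by rewrite /= -iterS -nth_c ?defN // nth_rcons ltnn eqxx.
case=> // j /andP[_]; rewrite ltnS => lt_jc fix_x.
have := nth_c j; rewrite defN nth_rcons lt_jc fix_x => /(_ (ltnW lt_jc)) xc.
by case/andP: uc => /negP[]; rewrite -xc mem_nth.
Qed.

(** The displacements d_j from [s] satisfy d_(j+1) = a d_j + d_1. *)
Lemma iter_affine (K : fieldType) (a c s : K) (j : nat) :
  iter j (fun u => a * u + c) s - s =
    (\sum_(i < j) a ^+ i) * (a * s + c - s).
Proof.
elim: j => [|j IHj]; first by rewrite big_ord0 mul0r subrr.
rewrite iterS big_ord_recl expr0.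
under eq_bigr do rewrite lift0 exprS.
rewrite -mulr_sumr mulrDl -mulrA -IHj; ring.
Qed.

(** By [iter_affine], a point with nonzero displacement returns exactly when the geometric sum
    vanishes, so [l] is the least positive index where it does. *)
Lemma affine_cycle_length (K : fieldType) (T : eqType) (f : T -> T)
    (P : K -> T) (a c : K) (l : nat) :
  injective P -> (forall s, f (P s) = P (a * s + c)) ->
  common_cycle_length f (range P) l -> (1 < l)%N ->
  \sum_(i < l) a ^+ i = 0 /\
  forall j, (0 < j < l)%N -> \sum_(i < j) a ^+ i != 0.
Proof.
move=> injP fP [[d cyc_d <-] _] l_gt1.
have [_ [[s _ <-] period min_period]] := cycle_period cyc_d.
have fix_iter j : iter j f (P s) = P (iter j (fun u => a * u + c) s).
  by elim: j => //= j ->.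
have nfix : a * s + c - s != 0.
  by apply/negP; rewrite subr_eq0 => /eqP fix_s;
    apply: (min_period 1); rewrite //= fP fix_s.
split.
  move: period; rewrite fix_iter => /injP/eqP.
  by rewrite -subr_eq0 iter_affine mulf_eq0 (negbTE nfix) orbF => /eqP.
move=> j /min_period; rewrite fix_iter => neq_s; apply/eqP => sum0.
by apply: neq_s; congr P; apply/eqP; rewrite -subr_eq0 iter_affine sum0 mul0r.
Qed.

(** Multiplying by [a ^+ j] and reversing the order of summation turns one sum into [a] times the
    other. *)
Lemma geometric_sum_inv (K : fieldType) (a : K) (j : nat) :
  a != 0 ->
  (\sum_(i < j) a^-1 ^+ i == 0) = (\sum_(i < j) a ^+ i == 0).
Proof.
move=> a0; have : (\sum_(i < j) a^-1 ^+ i) * a ^+ j = a * \sum_(i < j) a ^+ i.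
  rewrite (reindex_inj rev_ord_inj) mulr_suml mulr_sumr.
  apply: eq_bigr => i _ /=.
  have -> : a ^+ j = a ^+ (j - i.+1) * a ^+ i.+1 by rewrite -exprD subnK.
  by rewrite mulrA -exprMn mulVf // expr1n mul1r exprS.
move/(congr1 (eq_op^~ 0)); rewrite !mulf_eq0 (negbTE a0) /=.
by rewrite expf_eq0 (negbTE a0) andbF orbF.
Qed.

End AffineCycles.

(** * Explicit 2 by 2 matrices *)

Section Matrices.

Lemma mx22M (F : fieldType) (a b c d a' b' c' d' : F) :
  mx22 a b c d * mx22 a' b' c' d' =
  mx22 (a * a' + b * c') (a * b' + b * d') (c * a' + d * c') (c * b' + d * d').
Proof.
apply/matrixP=> i j; rewrite !mxE big_ord_recl big_ord1 !mxE.
by case: ifP => _; case: ifP.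
Qed.

Lemma mx22_1 (F : fieldType) : mx22 1 0 0 1 = 1 :> 'M[F]_2.
Proof. by apply/matrixP=> -[[|[|//]] i] -[[|[|//]] j]; rewrite !mxE. Qed.

Lemma mx22_inj (F : fieldType) (a b c d a' b' c' d' : F) :
  mx22 a b c d = mx22 a' b' c' d' -> [/\ a = a', b = b', c = c' & d = d'].
Proof.
move/matrixP=> E.
by have := (E 0 0, E 0 1, E 1 0, E 1 1); rewrite !mxE /= => -[[[-> ->] ->] ->].
Qed.

End Matrices.

(** * The order, its left ideals, and conjugation by [gamma] *)

Section Orders.
Variables (R : idomainType) (p : R) (n : nat).
Local Notation F := {fraction R}.
Local Notation iota := (@tofrac R).
Local Notation O := (order_O p n).
Local Notation gamma := (gamma_mx p n).
Local Notation alpha := (alpha_mx p).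

Lemma tofrac_inj : injective iota.
Proof. by move=> x y /eqP; rewrite tofrac_eq => /eqP. Qed.

(** The factor [p ^+ n] is split off [z] so that conjugation by [gamma] just swaps [x] with [t] and
    [y] with [z]. *)
Definition order_mx (x y z t : R) : 'M[F]_2 :=
  mx22 (iota x) (iota y) (iota (p ^+ n * z)) (iota t).

Lemma order_OP (A : 'M[F]_2) :
  O A <-> exists x y z t, A = order_mx x y z t.
Proof.
split=> [[x [y [_ [t [[z _ <-] ->]]]]]|[x [y [z [t ->]]]]].
  by exists x, y, z, t.
by exists x, y, (p ^+ n * z), t; split=> //; exists z.
Qed.

Lemma order_mxM (x y z t x' y' z' t' : R) :
  order_mx x y z t * order_mx x' y' z' t' =
  order_mx (x * x' + y * (p ^+ n * z')) (x * y' + y * t')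
           (z * x' + t * z') (p ^+ n * z * y' + t * t').
Proof. by rewrite mx22M -!rmorphM -!rmorphD; congr mx22; congr iota; ring. Qed.

Lemma order_mx_inj (x y z t x' y' z' t' : R) :
  order_mx x y z t = order_mx x' y' z' t' ->
  [/\ x = x', y = y', p ^+ n * z = p ^+ n * z' & t = t'].
Proof.
by case/mx22_inj=> /tofrac_inj-> /tofrac_inj-> /tofrac_inj-> /tofrac_inj->.
Qed.

Lemma order_mx_1 : order_mx 1 0 0 1 = 1.
Proof. by rewrite /order_mx mulr0 !rmorph0 !rmorph1 mx22_1. Qed.

Lemma order_O1 : O 1.
Proof. by rewrite -order_mx_1; apply/order_OP; exists 1, 0, 0, 1. Qed.

Lemma order_OM (A B : 'M[F]_2) : O A -> O B -> O (A * B).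
Proof.
move=> /order_OP[x [y [z [t ->]]]] /order_OP[x' [y' [z' [t' ->]]]].
by rewrite order_mxM; apply/order_OP; do 4 eexists.
Qed.

Lemma gamma_order_mx (x y z t : R) :
  gamma * order_mx x y z t = order_mx t z y x * gamma.
Proof.
rewrite /gamma_mx /order_mx !mx22M !rmorphM /=.
by congr mx22; ring.
Qed.

Lemma gamma_unit : p != 0 -> gamma \is a GRing.unit.
Proof.
move=> p0; apply/unitrP; exists (mx22 0 (iota (p ^+ n))^-1 1 0).
have u : iota (p ^+ n) != 0 by rewrite tofrac_eq0 expf_neq0.
by rewrite !mx22M !mulr0 !mul0r !mulr1 !addr0 !add0r mulVf // mulfV // mx22_1.
Qed.

Lemma gamma_conj_order (A : 'M[F]_2) :
  p != 0 -> O A -> O (gamma * A * gamma^-1).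
Proof.
move=> p0 /order_OP[x [y [z [t ->]]]].
by rewrite gamma_order_mx mulrK ?gamma_unit //; apply/order_OP; do 4 eexists.
Qed.

Lemma gamma_conjV_order (A : 'M[F]_2) :
  p != 0 -> O A -> O (gamma^-1 * A * gamma).
Proof.
move=> p0 /order_OP[x [y [z [t ->]]]].
rewrite -mulrA -gamma_order_mx mulKr ?gamma_unit //.
by apply/order_OP; do 4 eexists.
Qed.

Lemma right_translateM (u v : 'M[F]_2) (P : set 'M[F]_2) :
  right_translate u (right_translate v P) = right_translate (v * u) P.
Proof.
rewrite /right_translate image_comp.
by apply: eq_imagel => x _ /=; rewrite mulrA.
Qed.

(** The set [O v] is stable under left multiplication by [O]. *)
Lemma right_translate_sub (u v : 'M[F]_2) :
  right_translate v O u -> right_translate u O `<=` right_translate v O.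
Proof.
move=> [A OA <-] _ [B OB <-]; exists (B * A); first exact: order_OM.
by rewrite mulrA.
Qed.

Definition conj_set (g : 'M[F]_2) (P : set 'M[F]_2) : set 'M[F]_2 :=
  [set g^-1 * A * g | A in P].

Lemma conj_set_inj (g : 'M[F]_2) :
  g \is a GRing.unit -> injective (conj_set g).
Proof.
move=> ug P Q eqPQ.
have inj_g : injective (fun A : 'M[F]_2 => g^-1 * A * g).
  by move=> A B /(mulIr ug); apply: mulrI; rewrite unitrV.
apply/funext => A; rewrite -(image_inj inj_g) -[RHS](image_inj inj_g).
by rewrite -/(conj_set g P) eqPQ.
Qed.

(** With [g] equal to [gamma], this reduces the action on [S_2] to an action on [S_1]. *)
Lemma conj_set_translate (g u : 'M[F]_2) (P : set 'M[F]_2) :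
  g \is a GRing.unit ->
  right_translate u (conj_set g P) =
  conj_set g (right_translate (g * u * g^-1) P).
Proof.
move=> ug; rewrite /right_translate /conj_set !image_comp.
by apply: eq_imagel => A _ /=; rewrite !mulrA mulrVK.
Qed.

(** This holds because [gamma] normalizes [O]; it presents [S_2] as the conjugate of [S_1]. *)
Lemma conj_gamma_order (u : 'M[F]_2) : p != 0 ->
  right_translate (gamma^-1 * u * gamma) O =
  conj_set gamma (right_translate u O).
Proof.
move=> p0; have ug := gamma_unit p0; apply/seteqP; split.
  move=> _ [A OA <-]; exists (gamma * A * gamma^-1 * u).
    by exists (gamma * A * gamma^-1) => //; apply: gamma_conj_order.
  by rewrite !mulrA mulVr // mul1r.
move=> _ [_ [A OA <-] <-]; exists (gamma^-1 * A * gamma).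
  exact: gamma_conjV_order.
by rewrite !mulrA mulrK.
Qed.

(** * The affine action on the residue field *)

Section Residue.
Variables (k : fieldType) (red : {rmorphism R -> k}).
Hypothesis red_quot : is_quotient_map (principal_ideal p) red.
Hypothesis n_ge1 : (1 <= n)%N.
Variable b : k -> R.
Hypothesis b_repr : forall s, red (b s) = s.

Lemma red_p : red p = 0.
Proof. by apply/red_quot.2; exists 1; rewrite ?mulr1. Qed.

Lemma red_pn : red (p ^+ n) = 0.
Proof. by rewrite rmorphXn red_p expr0n eqn0Ngt n_ge1. Qed.

(** As [n] is positive, [O] reduces modulo [p] to upper triangular matrices over [k]. *)
Lemma order_mx_inv (x y z t x' y' z' t' : R) :
  order_mx x y z t * order_mx x' y' z' t' = 1 ->
  [/\ red x * red x' = 1, red x * red y' + red y * red t' = 0 &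
      red t * red t' = 1].
Proof.
rewrite order_mxM -order_mx_1 => /order_mx_inj[e1 e2 _ e3].
have := (congr1 red e1, congr1 red e2, congr1 red e3).
by rewrite !(rmorphD, rmorphM) /= red_pn !mul0r mulr0 addr0 add0r rmorph0 rmorph1
  => -[[-> ->] ->].
Qed.

Lemma translate_alpha_mem (x y z t : R) (s s' : k) :
  red x * s' = red y + red t * s ->
  right_translate (alpha (b s')) O (alpha (b s) * order_mx x y z t).
Proof.
move=> eq_s.
have /red_quot.2[e _ def_e] :
    red (y + b s * t - b s' * (x + b s * (p ^+ n * z))) = 0.
  rewrite !(rmorphB, rmorphD, rmorphM) /= red_pn !b_repr mul0r mulr0 addr0.
  by rewrite (mulrC s') eq_s; ring.
(* This is alpha_s w alpha_s'^-1. Only its upper right entry involves a division by [p], and the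
   relation between [s] and [s'] makes the quotient [e] exist in [R]. *)
exists (order_mx (x + b s * (p ^+ n * z)) e (p * z) (t - p ^+ n * z * b s')).
  by apply/order_OP; do 4 eexists.
rewrite /alpha_mx /order_mx -(rmorph1 iota) -(rmorph0 iota) !mx22M.
rewrite -!rmorphM -!rmorphD; congr mx22; congr iota; try by ring.
by rewrite (mulrC e) def_e; ring.
Qed.

Lemma translate_alpha (x y z t x' y' z' t' : R) (s : k) :
  order_mx x y z t * order_mx x' y' z' t' = 1 ->
  right_translate (order_mx x y z t) (right_translate (alpha (b s)) O) =
  right_translate (alpha (b (red t / red x * s + red y / red x))) O.
Proof.
move=> inv_w; have [xx' xy' tt'] := order_mx_inv inv_w.
have x0 : red x != 0.
  by apply/eqP => x0; move/eqP: xx'; rewrite x0 mul0r eq_sym oner_eq0.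
rewrite right_translateM; set s' := _ + _.
have eq_s : red x * s' = red y + red t * s by rewrite /s'; field.
apply/seteqP; split; first exact/right_translate_sub/translate_alpha_mem.
(* The inverse matrix sends [s'] back to [s], which yields the reverse inclusion. *)
have eq_s' : red x' * s = red y' + red t' * s'.
  apply: (mulfI x0); rewrite mulrA xx' mul1r mulrDr mulrCA eq_s.
  rewrite mulrDr [red t' * (_ * _)]mulrA (mulrC _ (red t)) tt' mul1r addrA.
  by rewrite (mulrC (red t')) xy' add0r.
have /right_translate_sub := translate_alpha_mem z' eq_s'.
move=> sub _ [A OA <-]; have /sub[B OB eq_B] : right_translate
    (alpha (b s') * order_mx x' y' z' t') O
    (A * (alpha (b s') * order_mx x' y' z' t')) by exists A.
exists B => //; rewrite mulrA eq_B -!mulrA.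
by rewrite [order_mx x' y' z' t' * _](mulmx1C inv_w) mulr1.
Qed.

(** If alpha_s = A alpha_s' with A in [O], the first column forces the upper left entry of A to be
    1; the upper right entries then agree modulo [p]. *)
Lemma alpha_coset_inj :
  injective (fun s => right_translate (alpha (b s)) O).
Proof.
move=> s s' /= eq_coset.
have : right_translate (alpha (b s')) O (alpha (b s)).
  by rewrite -eq_coset; exists 1; [exact: order_O1 | rewrite mul1r].
move=> [_ /order_OP[x [y [z [t ->]]]]].
rewrite /alpha_mx /order_mx -(rmorph1 iota) -(rmorph0 iota) mx22M.
rewrite -!rmorphM -!rmorphD => /mx22_inj[/tofrac_inj e1 /tofrac_inj e2 _ _].
rewrite -(b_repr s) -e2 !(rmorphD, rmorphM) /= red_p mulr0 addr0 b_repr.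
by move: e1; rewrite mulr1 mulr0 addr0 => ->; rewrite rmorph1 mul1r.
Qed.

End Residue.

End Orders.

(** * Comparison of the two cycle lengths *)

Theorem theorem5p5 (R : idomainType) (p : R)
    (R_dvr : is_dvr (principal_ideal p)) (R_complete : adically_complete p)
    (k : finFieldType) (red : {rmorphism R -> k})
    (red_quot : is_quotient_map (principal_ideal p) red)
    (n : nat) (n_ge1 : (1 <= n)%N)
    (b : k -> R) (b_repr : forall s : k, red (b s) = s)
    (w : 'M[{fraction R}]_2) (w_unit : order_units p n w)
    (l1 l2 : nat)
    (cycles1 : common_cycle_length (right_translate w) (S_1 p n b) l1)
    (cycles2 : common_cycle_length (right_translate w) (S_2 p n b) l2)
    (l1_gt1 : (1 < l1)%N) (l2_gt1 : (1 < l2)%N)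
    (q_or_disc : prime #|k| \/
       ~ ((@tofrac R) @` principal_ideal p) (\tr w ^+ 2 - 4%:R * \det w)) :
  l1 = l2.
Proof.
have p0 : p != 0.
  apply/eqP => p0; case: R_dvr => _ _ [].
  apply/seteqP; split=> y /=; first by case=> x _ <-; rewrite p0 mul0r.
  by move=> ->; exists 0; rewrite ?mulr0.
have ug := gamma_unit n p0.
case: w_unit cycles1 cycles2 => /order_OP[x [y [z [t def_w]]]].
move=> [_ [/order_OP[x' [y' [z' [t' ->]]]]]]; rewrite def_w.
move=> wV _ cycles1 cycles2.
(* Conjugating by [gamma] the relation between [w] and its inverse makes [translate_alpha] available
   for the action on [S_2]. *)
have wgV : order_mx p n t z y x * order_mx p n t' z' y' x' = 1.
  apply: (mulIr ug); rewrite -mulrA -gamma_order_mx mulrA -gamma_order_mx.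
  by rewrite -mulrA wV mulr1 mul1r.
have [xx' _ tt'] := order_mx_inv red_quot n_ge1 wV.
have a0 : red t / red x != 0.
  rewrite mulf_neq0 ?invr_eq0 //; apply/eqP => e.
    by move/eqP: tt'; rewrite e mul0r eq_sym oner_eq0.
  by move/eqP: xx'; rewrite e mul0r eq_sym oner_eq0.
have injP := @alpha_coset_inj _ p n _ _ red_quot _ b_repr.
have [sum1 min1] := affine_cycle_length injP
  (fun s => translate_alpha red_quot n_ge1 b_repr s wV) cycles1 l1_gt1.
have S2E : S_2 p n b = range (fun s => conj_set (gamma_mx p n)
    (right_translate (alpha_mx p (b s)) (order_O p n))).
  by apply: eq_imagel => s _; rewrite conj_gamma_order.
rewrite S2E in cycles2.
have [] := @affine_cycle_length _ _ _ _ (red t / red x)^-1 (red z / red t) _ _ _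
  cycles2 l2_gt1.
- by move=> s s' /(conj_set_inj ug)/injP.
- move=> s; rewrite conj_set_translate // gamma_order_mx mulrK //.
  by rewrite (translate_alpha red_quot n_ge1 b_repr s wgV) invf_div.
move=> /eqP; rewrite geometric_sum_inv // => sum2 min2.
(* Both lengths are the first positive zero of the same geometric sums, so a smaller one would
   contradict the minimality of the other. *)
case: (ltngtP l1 l2) => // [lt12|lt21].
  have /min2/negP[] : (0 < l1 < l2)%N by rewrite lt12 ltnW.
  by rewrite geometric_sum_inv // sum1.
by have /min1/negP[] : (0 < l2 < l1)%N by rewrite lt21 ltnW.
Qed.
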